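(* Let $\varepsilon\in(0,\tfrac12)$. There exists $n_0=n_0(\varepsilon)$ such that for all $n>n_0$ and all integers $t$ with $n^{0.99}<t<n-n^{1/2+\varepsilon}$, writing $u=n-t$, the following holds: if $\mathcal F\subseteq\Sigma_n$ is $t$-intersecting, then there exists a family $\mathcal S$ of partial permutations such that (a) every element of $\mathcal S$ has size at most $t+0.001u$; (b) $|\mathcal F\setminus \mathcal F[\mathcal S]|<\frac1n\cdot u!$; and (c) $\mathcal S$ is $t$-intersecting.
   Context: Each permutation $\sigma$ of $[n]=\{1,\dots,n\}$ is identified with the set $\{(1,\sigma(1)),\dots,(n,\sigma(n))\}\subseteq[n]^2$, and $\Sigma_n$ denotes the collection of these $n$-element sets. A partial permutation is a subset of some element of $\Sigma_n$. A family of sets is $t$-intersecting if any two (not necessarily distinct) members $A,B$ satisfy $|A\cap B|\ge t$. For a family $\mathcal F$ and a set $X$, $\mathcal F[X]=\{F\in\mathcal F: X\subseteq F\}$, and for a family $\mathcal S$, $\mathcal F[\mathcal S]=\bigcup_{A\in\mathcal S}\mathcal F[A]$. *)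

(* Defs.v *)
From mathcomp Require Import all_boot all_fingroup.
From Stdlib Require Import Reals.

Set Implicit Arguments.
Unset Strict Implicit.
Unset Printing Implicit Defensive.

Definition perm_graph (n : nat) (s : 'S_n) : {set 'I_n * 'I_n} :=
  [set (i, s i) | i : 'I_n].

Definition in_Sigma (n : nat) (A : {set 'I_n * 'I_n}) : Prop :=
  exists s : 'S_n, A = perm_graph s.

Definition partial_perm (n : nat) (A : {set 'I_n * 'I_n}) : Prop :=
  exists s : 'S_n, A \subset perm_graph s.

Definition t_intersecting (T : finType) (t : nat) (F : {set {set T}}) : Prop :=
  forall A B, A \in F -> B \in F -> t <= #|A :&: B|.

Definition restr (T : finType) (F : {set {set T}}) (X : {set T}) : {set {set T}} :=
  [set G in F | X \subset G].

Definition restrS (T : finType) (F S : {set {set T}}) : {set {set T}} :=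
  \bigcup_(A in S) restr F A.

(* Main.v *)
Require Import Defs.
From mathcomp Require Import all_boot all_fingroup.
From Stdlib Require Import Reals Lra.
Import ssrnat.
From mathcomp Require Import zify.

Set Implicit Arguments.
Unset Strict Implicit.
Unset Printing Implicit Defensive.

(** Let [u = n - t] and call [Y] an [r]-spread centre of [F] if some nonempty
    subfamily [H] of [F], all of whose members contain [Y], satisfies
    [|H[Z]| <= r ^ - |Z \ Y| * |H|] for all [Z] containing [Y].

    Two [r]-spread centres of a [t]-intersecting family meet in at least
    [t - O(u / r)] elements. Hence, if the centres of size at most [t + j] cover
    all but few members of [F], double counting along a [(t - O(u / r))]-subset
    of one centre shows that the centres of size at most [t + j - 1] still cover
    all but few. With [r] a small power of [n] the loss per step is bounded by
    about [(n r / u ^ 2) ^ j * u!], negligible because [u > n ^ (1/2 + eps)],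
    and the defect [O(u / r)] does not build up, since the centres are always
    those of the original family. This goes down to [j = u / w ^ 4], where
    [w = n ^ (1 / K)]. A last step of the same kind with the much larger spread
    [r = u / w ^ 2] yields centres of size at most [t + u / w ^ 3 + o(u / w ^ 3)];
    now [r] exceeds the difference of two centres, so a weak form of the
    Alweiss-Lovasz-Wu-Zhang spread lemma provides members [A] and [B] of [F] above any two
    centres whose intersection is that of the centres, which therefore is of
    size at least [t]. *)

(** * Factorials and binomials *)

Lemma leq_exp_base a b s : a <= b -> a ^ s <= b ^ s.
Proof. by case: s => [|s] ab; rewrite // leq_exp2r. Qed.

Lemma ffact_ge_exp a s : a ^ s <= (a + s) ^_ s.
Proof.
elim: s a => [|s IH] a; first by rewrite ffactn0.
by rewrite addnS ffactSS expnS leq_mul //; lia.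
Qed.

Lemma ffact_le_exp a s : a ^_ s <= a ^ s.
Proof.
elim: s => [|s IH]; first by rewrite ffactn0.
by rewrite ffactnSr expnSr leq_mul // leq_subr.
Qed.

Lemma bin_le_exp2 a k : 'C(a, k) <= 2 ^ a.
Proof.
elim: a k => [|a IH] [|k] //; first by rewrite bin0 expn_gt0.
rewrite binS expnS mul2n -addnn leq_add //; exact: IH.
Qed.

(** The falling factorial of [2k] of length [k] dominates [k ^ k], and it is a central binomial
    coefficient times the factorial of [k]. *)
Lemma expnn_le_fact k : k ^ k <= 4 ^ k * k`!.
Proof.
apply: leq_trans (ffact_ge_exp k k) _.
rewrite -bin_ffact leq_mul2r (_ : 4 = 2 ^ 2) // -expnM mul2n -addnn.
by rewrite bin_le_exp2 orbT.
Qed.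

(** The usual bound of a binomial coefficient by the [k]-th power of [4b / k], kept free of
    division. *)
Lemma bin_mul_exp_le b k : 'C(b, k) * k ^ k <= (4 * b) ^ k.
Proof.
apply: leq_trans (leq_mul (leqnn _) (expnn_le_fact k)) _.
by rewrite mulnCA bin_ffact expnMn leq_mul // ffact_le_exp.
Qed.

Lemma bin_le_exp a k : 'C(a, k) <= a ^ k.
Proof.
apply: leq_trans (ffact_le_exp a k).
by rewrite -bin_ffact leq_pmulr // fact_gt0.
Qed.

(** If [2s <= a], each factor of the falling factorial is at least [a / 2]. Otherwise
    [4 ^ a <= 16 ^ s], and the bound on [a ^ a] by the factorial of [a] suffices after cancelling
    [a ^ (a - s)]. *)
Lemma exp_le_ffact a s : s <= a -> a ^ s <= 16 ^ s * a ^_ s.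
Proof.
move=> sa; case: (leqP (2 * s) a) => h.
  have h2 : a ^ s <= 2 ^ s * a ^_ s.
    elim: s sa h => [|s IH] sa h; first by rewrite ffactn0.
    rewrite expnSr ffactnSr expnSr mulnACA leq_mul //; last by lia.
    by apply: IH; lia.
  by apply: leq_trans h2 _; rewrite leq_mul // leq_exp_base.
have [a0|a0] := posnP a; first by move: sa; rewrite a0 leqn0 => /eqP->.
have : a ^ s * a ^ (a - s) <= (16 ^ s * a ^_ s) * a ^ (a - s).
  rewrite -expnD subnKC //; apply: leq_trans (expnn_le_fact a) _.
  rewrite -(ffact_fact sa) mulnA leq_mul //; last first.
    apply: leq_trans (_ : (a - s) ^ (a - s) <= _); last first.
      by rewrite leq_exp_base // leq_subr.
    by rewrite -ffactnn ffact_le_exp.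
  by rewrite leq_mul // (_ : 16 = 4 ^ 2) // -expnM leq_exp2l //; lia.
by rewrite leq_pmul2r // expn_gt0 a0.
Qed.

(** * Spread families *)

(** The inequality is multiplied out to avoid division; for [Z] containing [Y] the exponent is the
    size of [Z \ Y]. *)
Definition spread (T : finType) (r : nat) (Y : {set T}) (H : {set {set T}}) : bool :=
  [&& H != set0, [forall A in H, Y \subset A]
    & [forall Z : {set T}, (Y \subset Z) ==> (#|restr H Z| * r ^ (#|Z| - #|Y|) <= #|H|)]].

Definition centers (T : finType) (r q : nat) (F : {set {set T}}) : {set {set T}} :=
  [set Y : {set T} | (#|Y| <= q) && [exists H : {set {set T}}, (H \subset F) && spread r Y H]].

Lemma card_bigcup_le (I T : finType) (P : pred I) (E : I -> {set T}) :
  #|\bigcup_(i | P i) E i| <= \sum_(i | P i) #|E i|.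
Proof.
elim/big_rec2: _ => [|i n A _ IH]; first by rewrite cards0.
by apply: leq_trans (leq_card_setU _ _) _; rewrite leq_add2l.
Qed.

Section Spread.
Variable T : finType.
Implicit Types (A B X Y Z D : {set T}) (F G H S : {set {set T}}).

Lemma spreadP r Y H :
  reflect [/\ exists A, A \in H, forall A, A \in H -> Y \subset A
    & forall Z, Y \subset Z -> #|restr H Z| * r ^ (#|Z| - #|Y|) <= #|H|] (spread r Y H).
Proof.
apply: (iffP and3P) => -[].
  by move=> /set0Pn ? /forall_inP ? /forallP h; split => // Z YZ; have := h Z; rewrite YZ.
move=> h1 h2 h3; split; [exact/set0Pn|exact/forall_inP|].
by apply/forallP => Z; apply/implyP; apply: h3.
Qed.

Lemma centersP r q F Y :
  reflect (#|Y| <= q /\ exists2 H : {set {set T}}, H \subset F & spread r Y H) (Y \in centers r q F).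
Proof.
rewrite inE; apply: (iffP andP) => -[-> h]; split=> //.
  by have /existsP[H /andP[]] := h; exists H.
by apply/existsP; case: h => H h1 h2; exists H; rewrite h1.
Qed.

Lemma in_restr F X A : (A \in restr F X) = (A \in F) && (X \subset A).
Proof. by rewrite inE. Qed.

Lemma restrSP F S A : reflect (A \in F /\ exists2 X : {set T}, X \in S & X \subset A) (A \in restrS F S).
Proof.
apply: (iffP bigcupP) => [[X XS]|[AF [X XS XA]]].
  by rewrite in_restr => /andP[-> XA]; split=> //; exists X.
by exists X; rewrite // in_restr AF.
Qed.

(* A maximal [Y] among those on which the density of [G] has increased by a
   factor [r] per added element. *)
Lemma spread_restr_exists r G X : 0 < r -> restr G X != set0 ->
  exists2 Y : {set T}, X \subset Y & spread r Y (restr G Y) /\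
    #|restr G X| <= #|restr G Y| * r ^ (#|Y| - #|X|).
Proof.
move=> r0 G0.
pose P Y := (X \subset Y) && (#|restr G X| <= #|restr G Y| * r ^ (#|Y| - #|X|)).
have PX : P X by rewrite /P subxx subnn muln1 leqnn.
have [Y /andP[XY hY] maxY] := arg_maxnP (fun Y => #|Y|) PX.
exists Y => //; split=> //; apply/spreadP; split.
- apply/set0Pn; apply: contraTneq hY => ->.
  by rewrite cards0 mul0n -ltnNge card_gt0.
- by move=> A; rewrite in_restr => /andP[].
move=> Z YZ; have -> : restr (restr G Y) Z = restr G Z.
  apply/setP => A; rewrite !in_restr -andbA; congr andb.
  by apply/andP/idP => [[]|ZA] //; split=> //; apply: subset_trans ZA.
have [->|neYZ] := eqVneq Y Z; first by rewrite subnn muln1.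
have ltYZ : #|Y| < #|Z| by rewrite proper_card // properEneq neYZ.
have XZ := subset_trans XY YZ.
(* By maximality [Z] fails the density inequality that [Y] satisfies; comparing the two gives the
   spread condition at [Z]. *)
have : ~~ P Z by apply: contraL ltYZ => /maxY; rewrite -leqNgt.
rewrite /P XZ -ltnNge => hZ.
have := leq_trans (ltnW hZ) hY.
rewrite (_ : #|Z| - #|X| = (#|Z| - #|Y|) + (#|Y| - #|X|)); last first.
  by have := subset_leq_card XY; lia.
by rewrite expnD mulnA leq_pmul2r // expn_gt0 r0.
Qed.

(** Union bound: a set meeting [D] in at least [k] points contains one of the [k]-subsets of [D]. *)
Lemma card_subsets_ge (G : {set {set T}}) D k (r N : nat) :
  (forall Z, Z \subset D -> #|Z| = k -> #|restr G Z| * r ^ k <= N) ->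
  #|[set A in G | k <= #|A :&: D|]| * r ^ k <= 'C(#|D|, k) * N.
Proof.
move=> h.
pose PK := [set Z : {set T} | Z \subset D & #|Z| == k].
have sub : [set A in G | k <= #|A :&: D|] \subset \bigcup_(Z in PK) restr G Z.
  apply/subsetP => A; rewrite inE => /andP[AG /card_geqP].
  case=> s [us sk sAD]; apply/bigcupP; exists [set x in s].
    rewrite inE; apply/andP; split; last by rewrite cardsE (card_uniqP us) sk.
    by apply/subsetP => x; rewrite inE => /sAD; rewrite inE => /andP[].
  rewrite in_restr AG; apply/subsetP => x; rewrite inE => /sAD.
  by rewrite inE => /andP[].
apply: leq_trans (leq_mul (subset_leq_card sub) (leqnn _)) _.
apply: leq_trans (leq_mul (card_bigcup_le _ _) (leqnn _)) _.
rewrite big_distrl /= -cards_draws -sum_nat_const leq_sum // => Z.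
by rewrite inE => /andP[ZD /eqP]; apply: h.
Qed.

(** If every member met [D] in [k] points, the union bound over [k]-subsets of [D] would give
    [r ^ k <= 'C(#|D|, k)]. Disjointness from [Y] makes each such subset cost the full factor
    [r ^ k]. *)
Lemma spread_avoid r Y H D k : spread r Y H -> [disjoint D & Y] ->
  'C(#|D|, k) < r ^ k -> exists2 A, A \in H & #|A :&: D| < k.
Proof.
move=> /spreadP[[A0 A0H] HY h] dDY hk.
have H0 : 0 < #|H| by apply/card_gt0P; exists A0.
have /card_subsets_ge le : forall Z, Z \subset D -> #|Z| = k ->
    #|restr H Z| * r ^ k <= #|H|.
  move=> Z ZD Zk; apply: leq_trans (h (Y :|: Z) (subsetUl _ _)).
  have -> : restr H (Y :|: Z) = restr H Z.
    apply/setP => A; rewrite !in_restr subUset.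
    by case: (boolP (A \in H)) => // /HY ->.
  suff -> : #|Y :|: Z| - #|Y| = k by [].
  rewrite cardsU disjoint_setI0 ?cards0; last first.
    by rewrite disjoint_sym; apply: disjointWl dDY.
  by rewrite subn0 addKn.
have [//|no] := boolP [exists A in H, #|A :&: D| < k].
  by move=> /exists_inP.
move: le; have -> : [set A in H | k <= #|A :&: D|] = H.
  apply/setP => A; rewrite inE; case: (boolP (A \in H)) => //= AH.
  by move/exists_inPn: no => /(_ A AH); rewrite -leqNgt.
by rewrite mulnC leq_pmul2r // leqNgt hk.
Qed.

Lemma bin_lt_exp b k r : 0 < k -> 4 * b < r * k -> 'C(b, k) < r ^ k.
Proof.
move=> k0 h; rewrite -(@ltn_pmul2r (k ^ k)) ?expn_gt0 ?k0 //.
by apply: leq_ltn_trans (bin_mul_exp_le _ _) _; rewrite -expnMn ltn_exp2r.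
Qed.

(** Let [k] be the shortfall of the intersection below [t], assumed larger than [i]. Pick [A] above
    [Y1] almost avoiding [Y2 \ Y1], then [B] above [Y2] almost avoiding [A \ Y2]. Each choice adds
    fewer than [k / 2], rounded up, common points, so [A] and [B] share fewer than [t]. *)
Lemma spread_near (n t r i : nat) F Y1 Y2 H1 H2 : t <= n ->
  (forall A, A \in F -> #|A| = n) -> t_intersecting t F ->
  8 < r -> 8 * (n - t) <= (r - 8) * i ->
  H1 \subset F -> H2 \subset F -> spread r Y1 H1 -> spread r Y2 H2 ->
  t <= #|Y1 :&: Y2| + i.
Proof.
move=> tn Fn Ft r8 hi /subsetP H1F /subsetP H2F s1 s2; rewrite leqNgt; apply/negP => lt.
set k := t - #|Y1 :&: Y2|; pose k1 := uphalf k.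
have k0 : 0 < k by rewrite /k; lia.
have ki : i < k by rewrite /k; lia.
have k1k : k <= 2 * k1 <= k.+1 by rewrite /k1; lia.
(* From [8 (n - t) <= (r - 8) i < (r - 8) k] one gets [8 (n - t + k) < r k], which is at most
   [2 r k1]. *)
have bin b : b <= n - t + k -> 'C(b, k1) < r ^ k1.
  move=> hb; apply: bin_lt_exp; first by lia.
  have : (r - 8) * i < (r - 8) * k by rewrite ltn_pmul2l //; lia.
  have : r * k <= r * (2 * k1) by rewrite leq_mul2l; lia.
  rewrite mulnBl; nia.
have cY Y H : H \subset F -> spread r Y H -> #|Y| <= n.
  move=> /subsetP HF /spreadP[[A AH] HY _].
  by rewrite -(Fn A) ?HF // subset_leq_card // HY.
have d1 : [disjoint Y2 :\: Y1 & Y1].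
  by rewrite -setI_eq0 setDE -setIA (setIC _ Y1) setICr setI0.
have c2 : #|Y2 :\: Y1| <= n - t + k.
  have : #|Y2| <= n by apply: cY s2; apply/subsetP.
  by rewrite cardsD setIC /k; lia.
have [A AH1 hA] := spread_avoid s1 d1 (bin _ c2).
have cA := Fn A (H1F A AH1).
have /spreadP[_ H1Y _] := s1.
have AI : #|A :&: Y2| < #|Y1 :&: Y2| + k1.
  have : #|A :&: Y2| <= #|(Y1 :&: Y2) :|: (A :&: (Y2 :\: Y1))|.
    apply: subset_leq_card; apply/subsetP => x; rewrite !inE.
    by case/andP=> -> ->; case: (x \in Y1).
  by move=> /leq_trans/(_ (leq_card_setU _ _)); lia.
have d2 : [disjoint A :\: Y2 & Y2].
  by rewrite -setI_eq0 setDE -setIA (setIC _ Y2) setICr setI0.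
have cA2 : #|A :\: Y2| <= n - t + k.
  have : #|Y1 :&: Y2| <= #|A :&: Y2| by rewrite subset_leq_card // setSI // H1Y.
  by rewrite cardsD cA /k; lia.
have [B BH2 hB] := spread_avoid s2 d2 (bin _ cA2).
have := Ft A B (H1F _ AH1) (H2F _ BH2).
have : #|A :&: B| <= #|(A :&: Y2) :|: (B :&: (A :\: Y2))|.
  apply: subset_leq_card; apply/subsetP => x; rewrite !inE.
  by case/andP=> -> ->; case: (x \in Y2).
move=> /leq_trans/(_ (leq_card_setU _ _)); rewrite /k in k1k; lia.
Qed.
End Spread.

(** * A weak spread lemma *)

Section Fragments.
Variables T I C : finType.
Implicit Types (W D Z : {set T}) (K : pred I) (B : I -> {set T}) (f : {ffun T -> C}).

Definition cell (c : C) f : {set T} := [set x | f x == c].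

Definition recolor (c : C) f D : {ffun T -> C} := [ffun x => if x \in D then c else f x].

(* What is missing from [W] in a cheapest member of the family [B] contained
   in [W :|: B i]. *)
Definition fragment K B W (i : I) : {set T} :=
  B [arg min_(k < i | K k && (B k \subset W :|: B i)) #|B k :\: W|] :\: W.

Lemma fragmentP K B W i : K i ->
  exists k, [/\ K k, fragment K B W i = B k :\: W, B k \subset W :|: B i &
    forall l, K l -> B l \subset W :|: B i -> #|fragment K B W i| <= #|B l :\: W|].
Proof.
move=> Ki; rewrite /fragment; case: arg_minnP => [|k /andP[Kk kW] mink].
  by rewrite Ki subsetUr.
by exists k; split=> // l Kl lW; apply: mink; rewrite Kl.
Qed.

Lemma fragment_sub K B W i : K i -> fragment K B W i \subset B i.
Proof. by move=> /(fragmentP B W)[k [_ -> kW _]]; rewrite subDset. Qed.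

Lemma fragment_disjoint K B W i : [disjoint fragment K B W i & W].
Proof. by rewrite -setI_eq0 /fragment setDE -setIA (setIC _ W) setICr setI0. Qed.

Lemma cell_recolor c f D : cell c (recolor c f D) = cell c f :|: D.
Proof.
by apply/setP => x; rewrite !inE ffunE; case: (x \in D); rewrite ?eqxx ?orbT ?orbF.
Qed.

Lemma cell_recolor_neq c d f D : c != d -> [disjoint D & cell c f] ->
  cell c (recolor d f D) = cell c f.
Proof.
move=> cd dis; apply/setP => x; rewrite !inE ffunE; case: ifP => // xD.
have := disjointFr dis xD; rewrite inE => ->.
by rewrite eq_sym (negPf cd).
Qed.

(** A preimage agrees with [g] off [D], so only its values on [D] are free. *)
Lemma card_recolor_preim c D (g : {ffun T -> C}) :
  #|[set f | recolor c f D == g]| <= #|C| ^ #|D|.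
Proof.
pose h (f : {ffun T -> C}) : {ffun T -> C} := [ffun x => if x \in D then f x else c].
rewrite -(@card_in_imset _ _ h).
  rewrite -(card_pffun_on c D (predT : pred C)); apply/subset_leq_card/subsetP => _ /imsetP[f _ ->].
  apply/pffun_onP; split=> //; apply/supportP => x xD; by rewrite ffunE (negPf xD).
move=> f f'; rewrite !inE => /eqP e1 /eqP e2 /ffunP e; apply/ffunP => x.
have := e x; rewrite !ffunE; case: ifP => // xD _.
have /ffunP/(_ x) : recolor c f D = recolor c f' D by rewrite e1 e2.
by rewrite !ffunE xD.
Qed.

(* Recolouring the fragment of [i] with [c] loses little information: some
   member of the family, read off the new colouring alone, contains the
   fragment. *)
Lemma card_fragment_eq (c : C) (J : {set I}) (A : I -> {set T})
    (K : {ffun T -> C} -> pred I) (B : {ffun T -> C} -> I -> {set T}) (m r N t : nat) :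
  (forall f i, K f i -> [/\ i \in J, B f i \subset A i & #|B f i| <= m]) ->
  (forall f i D, K f i -> D \subset B f i ->
     K (recolor c f D) = K f /\ B (recolor c f D) = B f) ->
  (forall Z, #|[set i in J | Z \subset A i]| * r ^ #|Z| <= N) ->
  #|[set p : {ffun T -> C} * I |
      K p.1 p.2 & #|fragment (K p.1) (B p.1) (cell c p.1) p.2| == t]| * r ^ t
    <= #|C| ^ #|T| * 'C(m, t) * #|C| ^ t * N.
Proof.
move=> hK inv hs.
(* A member inside the colour class of [g], chosen from [g] alone; the empty set is a harmless
   default. *)
pose B0 (g : {ffun T -> C}) :=
  if [pick i | K g i && (B g i \subset cell c g)] is Some i then B g i else set0.
have cB0 g : #|B0 g| <= m.
  rewrite /B0; case: pickP => [i /andP[/hK[]] //|_]; by rewrite cards0.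
pose Q D (g : {ffun T -> C}) := setX [set f | recolor c f D == g] [set i in J | D \subset A i].
pose PD (g : {ffun T -> C}) := [set D : {set T} | D \subset B0 g & #|D| == t].
set bad := [set p | _ & _].
have sub : bad \subset \bigcup_g \bigcup_(D in PD g) Q D g.
  apply/subsetP => -[f i]; rewrite inE /= => /andP[Kfi /eqP ct].
  have [k [Kk Ek kW mink]] := fragmentP (B f) (cell c f) Kfi.
  set D := fragment (K f) (B f) (cell c f) i in ct Ek mink.
  have DB : D \subset B f i by apply: fragment_sub.
  have [iK iB] := inv f i D Kfi DB.
  apply/bigcupP; exists (recolor c f D) => //; apply/bigcupP; exists D; last first.
    have [iJ BA _] := hK _ _ Kfi.
    by rewrite !inE eqxx iJ (subset_trans DB).
  rewrite inE ct eqxx andbT /B0.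
  case: pickP => [l|/(_ k)]; rewrite iK iB cell_recolor; last first.
    by rewrite Kk Ek -subDset subxx.
  (* The chosen member [l] lies in the old class together with [D], so what it misses lies in [D].
     Minimality of the fragment makes it equal to [D], hence [D] is a [t]-subset of [B0 g]. *)
  case/andP=> Kl lW.
  have sD : B f l :\: cell c f \subset D by rewrite subDset.
  have lW' : B f l \subset cell c f :|: B f i.
    by apply: subset_trans lW _; rewrite setUS.
  have /eqP <- : B f l :\: cell c f == D by rewrite eqEcard sD mink.
  by rewrite subsetDl.
apply: leq_trans (leq_mul (subset_leq_card sub) (leqnn _)) _.
apply: leq_trans (leq_mul (card_bigcup_le _ _) (leqnn _)) _.
rewrite -card_ffun big_distrl /= -!mulnA -sum_nat_const leq_sum // => g _.
apply: leq_trans (leq_mul (card_bigcup_le _ _) (leqnn _)) _.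
apply: (@leq_trans (\sum_(D in PD g) #|C| ^ t * N)); last first.
  rewrite sum_nat_const leq_mul // /PD cards_draws leq_bin2l //.
rewrite big_distrl /= leq_sum // => D; rewrite inE => /andP[_ /eqP <-].
by rewrite cardsX -mulnA leq_mul // card_recolor_preim.
Qed.
End Fragments.

(** Summing [X / 64 ^ t] gives at most [X / 63]; the induction carries the exact finite sum,
    including the tail term [X]. *)
Lemma geometric_sum_le (c : nat -> nat) (X n : nat) :
  (forall t, 0 < t -> c t * 64 ^ t <= X) -> 63 * \sum_(1 <= t < n.+1) c t <= X.
Proof.
move=> h; suff : 63 * 64 ^ n * (\sum_(1 <= t < n.+1) c t) + X <= 64 ^ n * X.
  have p : 0 < 64 ^ n by rewrite expn_gt0.
  move=> le; rewrite -(leq_pmul2l p) mulnA (mulnC (64 ^ n)).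
  by apply: leq_trans le; rewrite leq_addr.
elim: n => [|n IH]; first by rewrite big_geq // muln0 add0n expn0 mul1n.
rewrite big_nat_recr //= mulnDr.
have := h n.+1 isT; rewrite (expnS 64 n) => hn.
set p := 64 ^ n in IH hn *; set s := \sum_(_ <= _ < _) _ in IH *.
nia.
Qed.

Lemma card_bigcup_ord_le (T : finType) (F : nat -> {set T}) n (P : pred nat) : ~~ P 0 ->
  #|\bigcup_(t < n.+1 | P t) F t| <= \sum_(1 <= t < n.+1) (if P t then #|F t| else 0).
Proof.
move=> P0; apply: leq_trans (card_bigcup_le _ _) _.
by rewrite big_mkcond -(big_mkord xpredT (fun t => if P t then #|F t| else 0)) big_ltn // (negPf P0).
Qed.

(* Two rounds of random colouring. In the first one all but few fragments have
   size at most [m1]; these form again a spread family, which is much more spread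
   than the size of its members, so that in the second round most fragments are empty. *)
Lemma card_uncovering_le (T I C : finType) (J : {set I}) (A : I -> {set T})
    (r m m1 : nat) (c1 c2 : C) :
  #|C| = 4 -> c1 != c2 -> J != set0 -> 0 < r ->
  (forall i, i \in J -> #|A i| <= m) ->
  (forall Z : {set T}, #|[set i in J | Z \subset A i]| * r ^ #|Z| <= 2 * #|J|) ->
  1024 * m <= m1 * r -> 256 * m1 <= r ->
  8 * #|[set f : {ffun T -> C} | [forall i in J, ~~ (A i \subset cell c1 f :|: cell c2 f)]]|
    <= 4 ^ #|T|.
Proof.
move=> C4 c12 J0 r0 Am hs hm hm1.
pose K1 (f : {ffun T -> C}) : pred I := mem J.
pose B1 (f : {ffun T -> C}) := A.
pose B2 f := fragment (mem J) A (cell c1 f).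
pose K2 f : pred I := fun i => (i \in J) && (#|B2 f i| <= m1).
pose bad1 t := [set p : {ffun T -> C} * I |
  K1 p.1 p.2 & #|fragment (K1 p.1) (B1 p.1) (cell c1 p.1) p.2| == t].
pose bad2 t := [set p : {ffun T -> C} * I |
  K2 p.1 p.2 & #|fragment (K2 p.1) (B2 p.1) (cell c2 p.1) p.2| == t].
set E := [set f | _]; set X := 4 ^ #|T| * (2 * #|J|).
(* Here [256 = 4 * 64]: the factor 4 pays for the recolouring, the factor 64 makes the sum over [t]
   small. *)
have cut (N b t : nat) : b * r ^ t <= #|C| ^ #|T| * N * #|C| ^ t * (2 * #|J|) ->
    N * 256 ^ t <= r ^ t -> b * 64 ^ t <= X.
  rewrite C4 => h1 h2; have rt0 : 0 < r ^ t by rewrite expn_gt0 r0.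
  rewrite -(leq_pmul2r rt0) mulnAC.
  apply: leq_trans (leq_mul h1 (leqnn _)) _.
  rewrite (_ : 256 = 4 * 64) // expnMn in h2.
  rewrite (_ : _ * _ = X * (N * (4 ^ t * 64 ^ t))); first by rewrite leq_mul.
  by rewrite /X; lia.
have h1 t : 0 < t -> (if m1 < t then #|bad1 t| else 0) * 64 ^ t <= X.
  move=> t0; case: ifP => [m1t|_]; last by rewrite mul0n.
  apply: (@cut 'C(m, t)).
    apply: (@card_fragment_eq _ _ _ c1 J A K1 B1 m r (2 * #|J|)) => //.
    by move=> f i iJ; split=> //; apply: Am.
  (* For [t > m1] the binomial bound reduces the claim to [1024 m <= t r]. *)
  have t1 : 0 < t ^ t by rewrite expn_gt0 t0.
  rewrite -(leq_pmul2r t1) mulnAC.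
  apply: leq_trans (leq_mul (bin_mul_exp_le _ _) (leqnn _)) _.
  rewrite -!expnMn leq_exp_base //; nia.
have h2 t : 0 < t -> (if 0 < t then #|bad2 t| else 0) * 64 ^ t <= X.
  move=> t0; rewrite t0; apply: (@cut 'C(m1, t)).
    apply: (@card_fragment_eq _ _ _ c2 J A K2 B2 m1 r (2 * #|J|)) => //.
      by move=> f i /andP[iJ ?]; split=> //; apply: fragment_sub.
    move=> f i D /andP[iJ _] DB.
    (* The second-round set avoids the first class, so recolouring it with [c2] leaves the first
       round unchanged. *)
    suff e : cell c1 (recolor c2 f D) = cell c1 f by rewrite /K2 /B2 e.
    apply: cell_recolor_neq => //; apply: disjointWl DB _.
    exact: fragment_disjoint.
  apply: leq_trans (leq_mul (bin_le_exp _ _) (leqnn _)) _.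
  by rewrite -!expnMn leq_exp_base // mulnC.
pose bad := \bigcup_(t : 'I_#|T|.+1 | m1 < t) bad1 t :|: \bigcup_(t : 'I_#|T|.+1 | 0 < t) bad2 t.
(* If the first fragment is small and the second is empty, some small first-round fragment lies in
   the class of [c2], so a member is covered by both classes, against the choice of [f]. *)
have sub : setX E J \subset bad.
  apply/subsetP => -[f i]; rewrite !inE => /andP[/forall_inP noA iJ] /=.
  have cT (D : {set T}) : #|D| < #|T|.+1 by rewrite ltnS max_card.
  case: (leqP #|B2 f i| m1) => small; last first.
    apply/orP; left; apply/bigcupP; exists (Ordinal (cT (B2 f i))) => //.
    by rewrite inE /= /K1 /B1 /B2 eqxx andbT.
  have K2i : K2 f i by rewrite /K2 iJ.
  apply/orP; right; apply/bigcupP.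
  exists (Ordinal (cT (fragment (K2 f) (B2 f) (cell c2 f) i))); last by rewrite inE /= K2i eqxx.
  rewrite /= lt0n cards_eq0; apply/negP => /eqP.
  have [k [/andP[kJ _] -> _ _]] := fragmentP (B2 f) (cell c2 f) K2i.
  move=> /eqP; rewrite setD_eq0 => kc2.
  have [l [lJ El lW _]] := @fragmentP _ _ (mem J) A (cell c1 f) k kJ.
  have /negP := noA l lJ; apply.
  rewrite -subDset; apply: subset_trans kc2; by rewrite /B2 El.
have := leq_trans (subset_leq_card sub) (leq_card_setU _ _); rewrite cardsX.
have := geometric_sum_le #|T| h1; have := geometric_sum_le #|T| h2.
have := @card_bigcup_ord_le _ bad1 #|T| (fun t => m1 < t) isT.
have := @card_bigcup_ord_le _ bad2 #|T| (fun t => 0 < t) isT.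
set s2 := \sum_(1 <= _ < _) _; set b2 := #|\bigcup_(_ < _ | _) _| => e2.
set s1 := \sum_(1 <= _ < _) _; set b1 := #|\bigcup_(_ < _ | _) _| => e1 g2 g1 le.
have J1 : 0 < #|J| by rewrite card_gt0.
rewrite -(leq_pmul2r J1); rewrite /X in g1 g2.
set p := 4 ^ #|T| in g1 g2 *.
have : 63 * (#|E| * #|J|) <= 2 * (p * (2 * #|J|)) by lia.
nia.
Qed.

(** Give two of four colours to each family. Each fails to have a member inside its colours for at
    most an eighth of the colourings, so some colouring serves both, and the members found have
    disjoint colours. *)
Lemma spread_disjoint (T I1 I2 : finType) (J1 : {set I1}) (J2 : {set I2})
    (A1 : I1 -> {set T}) (A2 : I2 -> {set T}) (r m m1 : nat) :
  J1 != set0 -> J2 != set0 -> 0 < r ->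
  (forall i, i \in J1 -> #|A1 i| <= m) -> (forall i, i \in J2 -> #|A2 i| <= m) ->
  (forall Z : {set T}, #|[set i in J1 | Z \subset A1 i]| * r ^ #|Z| <= 2 * #|J1|) ->
  (forall Z : {set T}, #|[set i in J2 | Z \subset A2 i]| * r ^ #|Z| <= 2 * #|J2|) ->
  1024 * m <= m1 * r -> 256 * m1 <= r ->
  exists i1 i2, [/\ i1 \in J1, i2 \in J2 & [disjoint A1 i1 & A2 i2]].
Proof.
move=> n1 n2 r0 s1 s2 h1 h2 hm hm1.
pose c (k : nat) : 'I_4 := inord k.
have cE k l : k < 4 -> l < 4 -> (c k == c l) = (k == l).
  by move=> k4 l4; rewrite -val_eqE /= !inordK.
have C4 : #|'I_4| = 4 by rewrite card_ord.
have := @card_uncovering_le T I1 'I_4 J1 A1 r m m1 (c 0) (c 1) C4 _ n1 r0 s1 h1 hm hm1.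
have := @card_uncovering_le T I2 'I_4 J2 A2 r m m1 (c 2) (c 3) C4 _ n2 r0 s2 h2 hm hm1.
rewrite !cE // => /(_ isT); set E2 := [set f | _] => c2 /(_ isT); set E1 := [set f | _] => c1.
have [f] : exists f, f \notin E1 :|: E2.
  apply/existsP; rewrite -negb_forall; apply/negP => /forallP all.
  have : #|{ffun T -> 'I_4}| <= #|E1 :|: E2|.
    by rewrite -cardsT subset_leq_card //; apply/subsetP.
  rewrite card_ffun C4 => /leq_trans/(_ (leq_card_setU _ _)).
  have : 0 < 4 ^ #|T| by rewrite expn_gt0.
  lia.
rewrite !inE negb_or => /andP[/forall_inPn[i1 i1J] /negPn w1 /forall_inPn[i2 i2J] /negPn w2].
exists i1, i2; split=> //; apply: disjointWl w1 _; apply: disjointWr w2 _.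
rewrite -setI_eq0; apply/eqP/setP => x; rewrite !inE.
case: (f x =P c 0) => [->|_]; first by rewrite !cE.
by case: (f x =P c 1) => [->|_]; first by rewrite !cE.
Qed.

(** * Centres of families of permutations *)

Lemma card_perm_graph n (s : 'S_n) : #|perm_graph s| = n.
Proof. by rewrite card_imset ?card_ord // => i j []. Qed.

Lemma in_perm_graph n (s : 'S_n) p : (p \in perm_graph s) = (p.2 == s p.1).
Proof.
case: p => i j; apply/imsetP/eqP => /= [[k _ [-> ->]]|->] //.
by exists i.
Qed.

(** Composing with the inverse of one permutation through [Y] injects the others into the
    permutations fixing the first coordinates of [Y]. *)
Lemma card_restr_Sigma_le n (F : {set {set 'I_n * 'I_n}}) (Y : {set 'I_n * 'I_n}) :
  (forall A, A \in F -> in_Sigma A) -> restr F Y != set0 ->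
  #|restr F Y| <= (n - #|Y|)`!.
Proof.
move=> FS /set0Pn[A0]; rewrite inE => /andP[/FS[s0 ->] Ys0].
pose D := [set p.1 | p in Y]; pose P := [set s : 'S_n | Y \subset perm_graph s].
have cD : #|D| = #|Y|.
  apply: card_in_imset => p q /(subsetP Ys0) + /(subsetP Ys0); rewrite !in_perm_graph.
  by case: p q => a b [c d] /= /eqP-> /eqP-> ->.
have -> : n - #|Y| = #|~: D|.
  by have := cardsC D; rewrite card_ord; lia.
rewrite -card_perm; apply: (@leq_trans #|P|).
  apply: leq_trans (leq_imset_card (@perm_graph n) _).
  apply/subset_leq_card/subsetP => A; rewrite inE => /andP[/FS[s ->] Ys].
  by apply: imset_f; rewrite inE.
rewrite -(@card_imset _ _ (fun s : 'S_n => (s * s0^-1)%g)); last exact: mulIg.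
apply/subset_leq_card/subsetP => _ /imsetP[s + ->].
rewrite inE => /subsetP Ys; rewrite unfold_in; apply/subsetP => x.
rewrite !inE permM; apply: contra => /imsetP[p pY ->].
have := Ys p pY; have := subsetP Ys0 p pY; rewrite !in_perm_graph => /eqP e /eqP <-.
by rewrite e permK.
Qed.

(** Every lost member meets a fixed [X0] of [S] in at least [tau] points. A most popular
    [tau]-subset [X] of [X0] is enlarged to a spread centre [Y], and the lost members above [Y] are
    counted by a factorial. *)
Lemma card_remainder_le n (F S : {set {set 'I_n * 'I_n}}) (r s q tau : nat) :
  (forall A, A \in F -> in_Sigma A) -> 0 < r ->
  (forall X, X \in S -> #|X| <= s) ->
  (forall X X', X \in S -> X' \in S -> tau <= #|X :&: X'|) ->
  let R := restrS F S :\: restrS F (centers r q F) in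
  R != set0 -> exists y, [/\ q < y, tau <= y, y <= n &
    #|R| <= 'C(s, tau) * (r ^ (y - tau) * (n - y)`!)].
Proof.
move=> FS r0 Ss Sint R R0.
have RF : {subset R <= F} by move=> A; rewrite inE => /andP[_ /restrSP[]].
have /set0Pn[A0 A0R] := R0.
have [X0 X0S _] : exists2 X : {set 'I_n * 'I_n}, X \in S & X \subset A0.
  by move: A0R; rewrite inE => /andP[_ /restrSP[]].
pose PD := [set Z : {set 'I_n * 'I_n} | Z \subset X0 & #|Z| == tau].
have R_PD : [set A in R | tau <= #|A :&: X0|] = R.
  apply/setP => A; rewrite inE; case: (boolP (A \in R)) => //=.
  rewrite inE => /andP[_ /restrSP[_ [X XS XA]]].
  by apply: leq_trans (Sint X X0 XS X0S) _; rewrite subset_leq_card // setSI.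
have PD0 : 0 < #|PD|.
  have : tau <= #|X0| by rewrite -(setIid X0); apply: Sint.
  by rewrite /PD cards_draws bin_gt0.
have [X XPD maxX] := eq_bigmax_cond (fun Z => #|restr R Z|) PD0.
have RX : #|R| <= 'C(s, tau) * #|restr R X|.
  have := @card_subsets_ge _ R X0 tau 1 #|restr R X|; rewrite R_PD exp1n muln1.
  move=> h; apply: leq_trans (h _) _.
    move=> Z Z1 Z2; rewrite muln1 -maxX.
    by apply: (bigmax_sup Z); rewrite ?inE ?Z1 ?Z2 ?eqxx.
  by rewrite leq_mul // leq_bin2l // Ss.
have X0' : restr R X != set0.
  rewrite -card_gt0 lt0n; apply: contraTneq RX => ->.
  by rewrite muln0 -ltnNge card_gt0.
have cX : #|X| = tau by move: XPD; rewrite inE => /andP[_ /eqP].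
have [Y XY [spY leY]] := spread_restr_exists r0 X0'.
have /spreadP[[A AY] hY _] := spY.
have [AR YA] : A \in R /\ Y \subset A by apply/andP; move: AY; rewrite inE.
exists #|Y|; split.
(* Were [Y] of size at most [q], it would be an admissible centre below the lost member [A]. *)
- rewrite ltnNge; apply: contraL (AR) => Yq.
  rewrite inE negb_and negbK; apply/orP; left; apply/restrSP; split; first exact: RF.
  exists Y => //; apply/centersP; split=> //; exists (restr R Y) => //.
  by apply/subsetP => B; rewrite inE => /andP[/RF].
- by rewrite -cX subset_leq_card.
- have [a eA] := FS _ (RF _ AR).
  by apply: leq_trans (subset_leq_card YA) _; rewrite eA card_perm_graph.
apply: leq_trans RX _; rewrite leq_mul // -cX mulnC.
apply: leq_trans leY _; rewrite leq_mul //.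
apply: card_restr_Sigma_le => [B /RF /FS//|].
by apply/set0Pn; exists A.
Qed.

(** Otherwise discard the members meeting the other centre outside their own. The remaining residues
    are still spread up to a factor 2, so two of them are disjoint, and the corresponding members
    meet only inside [Y1 :&: Y2]. *)
Lemma centers_t_intersecting (T : finType) (n t r q i m1 : nat) (F : {set {set T}}) :
  t <= n -> t <= q -> (forall A, A \in F -> #|A| = n) -> t_intersecting t F ->
  8 < r -> 8 * (n - t) <= (r - 8) * i -> 2 * (q - t + i) <= r ->
  1024 * (n - t + i) <= m1 * r -> 256 * m1 <= r ->
  t_intersecting t (centers r q F).
Proof.
move=> tn tq Fn Ft r8 hi hq hm hm1 Y1 Y2 /centersP[q1 [H1 H1F s1]] /centersP[q2 [H2 H2F s2]].
rewrite leqNgt; apply/negP => lt.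
have near := spread_near tn Fn Ft r8 hi.
have near12 := near _ _ _ _ H1F H2F s1 s2.
(* At least half of [H] avoids the small set [Y' :\: Y]. *)
have half (Y Y' : {set T}) (H : {set {set T}}) : H \subset F -> spread r Y H -> #|Y :&: Y'| = #|Y1 :&: Y2| -> #|Y'| <= q ->
  let J := [set A in H | [disjoint A & Y' :\: Y]] in
  [/\ J != set0, forall A, A \in J -> #|A :\: Y| <= n - t + i &
   forall Z : {set T}, #|[set A in J | Z \subset A :\: Y]| * r ^ #|Z| <= 2 * #|J|].
  move=> HF sH cY Yq J.
  have /spreadP[[A AH] HY hsp] := sH.
  have H0 : 0 < #|H| by apply/card_gt0P; exists A.
  have cJ : #|H| <= 2 * #|J|.
    have c : #|[set A in H | 1 <= #|A :&: (Y' :\: Y)|]| * r ^ 1 <= 'C(#|Y' :\: Y|, 1) * #|H|.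
      apply: card_subsets_ge => Z ZD Z1.
      apply: leq_trans (hsp (Y :|: Z) (subsetUl _ _)); rewrite leq_mul //.
        apply/subset_leq_card/subsetP => B; rewrite !in_restr subUset => /andP[BH ->].
        by rewrite BH HY.
      rewrite cardsU (_ : Y :&: Z = set0) ?cards0 ?subn0 ?addKn ?Z1 //.
      apply/eqP; rewrite setI_eq0 disjoint_sym; apply: disjointWl ZD _.
      by rewrite -setI_eq0 setDE -setIA (setIC _ Y) setICr setI0.
    have cD : #|Y' :\: Y| <= q - t + i by rewrite cardsD setIC cY; lia.
    have cH : #|H| <= #|J| + #|[set A in H | 1 <= #|A :&: (Y' :\: Y)|]|.
      apply: leq_trans (leq_card_setU _ _); apply/subset_leq_card/subsetP => B BH.
      by rewrite !inE BH /= card_gt0 setI_eq0 orbN.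
    rewrite bin1 expn1 in c; nia.
  have JH B : B \in J -> B \in H by rewrite inE => /andP[].
  split=> [|B /JH BH|Z].
  - by rewrite -card_gt0; lia.
  (* The nearness bound applied to [Y] and itself gives [t <= #|Y| + i]. *)
  - have := near _ _ _ _ HF HF sH sH; rewrite setIid.
    have cB : #|B| = n by apply: Fn; apply: (subsetP HF).
    have := HY B BH; move/setIidPr => eB.
    by rewrite cardsD cB eB; lia.
  - apply: leq_trans cJ.
    have [->|/set0Pn[B]] := eqVneq [set A0 in J | Z \subset A0 :\: Y] set0.
      by rewrite cards0.
    rewrite inE => /andP[BJ ZB].
    apply: leq_trans (hsp (Y :|: Z) (subsetUl _ _)); rewrite leq_mul //.
      apply/subset_leq_card/subsetP => B'; rewrite in_restr subUset inE => /andP[/JH B'H].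
      by rewrite B'H (HY _ B'H) subsetD => /andP[].
    rewrite cardsU (_ : Y :&: Z = set0) ?cards0 ?subn0 ?addKn //.
    by apply/eqP; rewrite setI_eq0 disjoint_sym; move: ZB; rewrite subsetD => /andP[].
have [J1 m1' h1] := half Y1 Y2 H1 H1F s1 erefl q2.
have [J2 m2' h2] : _ := half Y2 Y1 H2 H2F s2 (f_equal (fun X : {set T} => #|X|) (setIC _ _)) q1.
have [A [B [AJ BJ dAB]]] := spread_disjoint J1 J2 (ltnW (ltn_trans (isT : 1 < 8) r8)) m1' m2' h1 h2 hm hm1.
move: AJ BJ; rewrite !inE => /andP[AH1 dA] /andP[BH2 dB].
have := Ft A B (subsetP H1F _ AH1) (subsetP H2F _ BH2); rewrite leqNgt => /negP; apply.
apply: leq_ltn_trans lt; apply/subset_leq_card/subsetP => x; rewrite !inE => /andP[xA xB].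
have := disjointFr dA xA; have := disjointFr dB xB; have := disjointFr dAB; move/(_ x).
by rewrite !inE xA xB; case: (x \in Y1); case: (x \in Y2) => //= /(_ isT).
Qed.

(** * Estimates *)

Lemma exp_mul_fact_le u y : y <= u -> u ^ y * (u - y)`! <= 16 ^ y * u`!.
Proof.
move=> yu; apply: leq_trans (leq_mul (exp_le_ffact yu) (leqnn _)) _.
by rewrite -mulnA ffact_fact.
Qed.

Lemma leq_cancel_mul a b p : 0 < p -> a * p <= b * p -> a <= b.
Proof. by move=> p0; rewrite leq_pmul2r. Qed.

Section Estimates.
Variables w K n t : nat.
Let u := n - t.
Hypotheses (tn : t <= n) (w0 : 5000 + 20 * K <= w)
  (hu : n * w ^ 16 <= u ^ 2) (hn : n <= w ^ (2 * K)).

Let wpos : 0 < w. Proof. by apply: leq_trans w0; rewrite addn_gt0. Qed.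

(** The binomial is about [n w^4 / u] to the power [j], the remaining factor about [w^8 / u] to the
    same power, and [u^2 >= n w^16] beats their product. The excess from [i] costs at most [w ^ j],
    since [4 n w^12 <= w ^ (2K + 13)]. *)
Lemma layer_arith i j y N :
  0 < n -> (2 * K + 13) * i <= j -> 0 < i -> u <= j * w ^ 4 -> j <= y -> y <= u ->
  16 * w ^ 8 <= u ->
  N <= 'C(t + j, t - i) * ((w ^ 8) ^ (t + y - (t - i)) * (u - y)`!) ->
  N * (4 * n) ^ 2 <= u`!.
Proof.
move=> n0 ij i0 uj jy yu ru hN.
have w8 : 0 < w ^ 8 by rewrite expn_gt0 wpos.
have u0 : 0 < u by apply: leq_trans ru; rewrite muln_gt0.
set m := t + j - (t - i).
have [e [me ei]] : exists e, m = j + e /\ e <= i by exists (m - j); rewrite /m; clear; lia.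
have [d yd] : exists d, y = j + d by exists (y - j); clear -jy; lia.
have cm : 'C(t + j, t - i) * j ^ m <= (4 * n) ^ m.
  rewrite -bin_sub; last by clear; lia.
  apply: leq_trans (leq_mul (leqnn _) (_ : j ^ m <= m ^ m)) _.
    by apply: leq_exp_base; rewrite me leq_addr.
  apply: leq_trans (bin_mul_exp_le _ _) _; apply: leq_exp_base.
  by rewrite leq_mul2l; move: jy yu; rewrite /u; clear -tn; lia.
have cu : 'C(t + j, t - i) * u ^ m <= (4 * n * w ^ 4) ^ m.
  apply: leq_trans (leq_mul (leqnn _) (leq_exp_base m uj)) _.
  by rewrite !(expnMn _ _ m) mulnA -(expnMn 4) leq_mul.
have step1 : N * (u ^ m * u ^ y) <= (4 * n * w ^ 4) ^ m * ((w ^ 8) ^ (y + i) * (16 ^ y * u`!)).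
  apply: leq_trans (leq_mul hN (leqnn _)) _.
  rewrite (_ : _ * _ = ('C(t + j, t - i) * u ^ m) * ((w ^ 8) ^ (t + y - (t - i)) * (u ^ y * (u - y)`!))); last by clear; lia.
  rewrite leq_mul // leq_mul //; last exact: exp_mul_fact_le.
  by rewrite leq_pexp2l //; clear; lia.
(* The surplus [d = y - j] cancels, as [16 w^8 <= u]. *)
have step2 : N * (u ^ 2) ^ j <= (4 * n * w ^ 4) ^ (j + i) * ((w ^ 8) ^ i * ((16 * w ^ 8) ^ j * u`!)).
  have ud : 0 < u ^ d by rewrite expn_gt0 u0.
  apply: (leq_cancel_mul ud).
  apply: leq_trans (_ : N * (u ^ m * u ^ y) <= _).
    rewrite -mulnA leq_mul // -expnM -!expnD leq_pexp2l //; by rewrite me yd; clear; lia.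
  apply: leq_trans step1 _; rewrite yd.
  rewrite (_ : (w ^ 8) ^ (j + d + i) * (16 ^ (j + d) * u`!) =
     ((w ^ 8) ^ i * ((16 * w ^ 8) ^ j * u`!)) * (16 * w ^ 8) ^ d); last first.
    by rewrite !expnD !expnMn; clear; lia.
  rewrite mulnA leq_mul ?leq_exp_base // leq_mul // me leq_pexp2l ?leq_add2l //.
  by rewrite (muln_gt0 (4 * n)) (muln_gt0 4) n0 (expn_gt0 w) wpos.
have step3 : N * w ^ (16 * j) <= (64 * w ^ 12) ^ j * ((4 * n * w ^ 12) ^ i * u`!).
  have nj : 0 < n ^ j by rewrite expn_gt0 n0.
  apply: (leq_cancel_mul nj); rewrite -mulnA.
  apply: leq_trans (leq_mul (leqnn _) (_ : _ <= (u ^ 2) ^ j)) _.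
    by rewrite expnM -expnMn leq_exp_base // mulnC.
  apply: leq_trans step2 _.
  rewrite (_ : 64 = 4 * 16) // (expnD w 4 8 : w ^ 12 = _) expnD !expnMn; clear; lia.
have step4 : N * w ^ (16 * j) <= w ^ (14 * j) * u`!.
  apply: leq_trans step3 _; rewrite mulnA leq_mul //.
  rewrite (_ : 14 * j = 13 * j + j); last by clear; lia.
  rewrite expnD leq_mul //.
    rewrite expnM leq_exp_base // (expnS w 12) leq_mul //; clear -w0; lia.
  apply: leq_trans (_ : w ^ ((2 * K + 13) * i) <= _); last by rewrite leq_pexp2l.
  rewrite expnM leq_exp_base // (_ : 2 * K + 13 = 1 + 2 * K + 12); last by clear; lia.
  by rewrite (expnD w (1 + 2 * K)) (expnD w 1) expn1 leq_mul // leq_mul //; clear -w0; lia.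
have step5 : N * w ^ (2 * j) <= u`!.
  have wj : 0 < w ^ (14 * j) by rewrite expn_gt0 wpos.
  apply: (leq_cancel_mul wj).
  rewrite -mulnA -expnD (mulnC u`!) (_ : 2 * j + 14 * j = 16 * j) //; clear; lia.
apply: leq_trans step5; rewrite leq_mul // (mulnC 2 j) expnM leq_exp_base //.
apply: leq_trans (_ : w ^ (1 + 2 * K) <= _); last by rewrite leq_pexp2l //; move: ij i0; clear; nia.
by rewrite expnD leq_mul // expn1; clear -w0; lia.
Qed.

(** The crude cost [n ^ (3x) <= w ^ (6 K x)] is affordable: [16 r w <= u] saves [w ^ y], and [y]
    exceeds [w x]. *)
Lemma final_arith i x y r N :
  0 < n -> i <= x -> 0 < x -> t + x <= n -> w * x < y -> y <= u -> r * w ^ 2 <= u ->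
  0 < u -> 0 < r ->
  N <= 'C(t + x, t - i) * (r ^ (t + y - (t - i)) * (u - y)`!) ->
  N * (4 * n) ^ 2 <= u`!.
Proof.
move=> n0 ix x0 txn wy yu ru u0 r0 hN.
have cm : 'C(t + x, t - i) <= n ^ (2 * x).
  rewrite -bin_sub; last by clear; lia.
  apply: leq_trans (bin_le_exp _ _) _.
  apply: leq_trans (leq_exp_base _ txn) _; rewrite leq_pexp2l //; clear -ix; lia.
have rn : r <= n.
  have : 0 < w ^ 2 by rewrite expn_gt0 wpos.
  by move=> w2; apply: leq_trans (leq_subr t n); apply: leq_trans ru; rewrite leq_pmulr.
have step1 : N * (u * w) ^ y <= n ^ (3 * x) * (u ^ y * u`!).
  rewrite expnMn mulnA.
  apply: leq_trans (_ : 'C(t + x, t - i) * (r ^ (y + i) * (16 ^ y * u`!)) * w ^ y <= _).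
    rewrite leq_mul //.
    apply: leq_trans (leq_mul hN (leqnn _)) _.
    rewrite -!mulnA leq_mul // (mulnC _`!) leq_mul //; last exact: exp_mul_fact_le.
    by rewrite leq_pexp2l //; clear; lia.
  rewrite (_ : _ * _ * _ = ('C(t + x, t - i) * r ^ i) * ((r * 16 * w) ^ y * u`!)); last first.
    by rewrite expnD !expnMn; clear; lia.
  rewrite leq_mul //.
    rewrite (_ : 3 * x = 2 * x + x); last by clear; lia.
    rewrite expnD leq_mul //; apply: leq_trans (leq_exp_base _ rn) _.
    by rewrite leq_pexp2l.
  rewrite leq_mul // leq_exp_base //; apply: leq_trans ru.
  by rewrite -mulnA leq_mul // expnS expn1 leq_mul //; clear -w0; lia.
have step2 : N * w ^ y <= w ^ (6 * K * x) * u`!.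
  have uy : 0 < u ^ y by rewrite expn_gt0 u0.
  apply: (leq_cancel_mul uy).
  apply: leq_trans (_ : N * (u * w) ^ y <= _); first by rewrite expnMn; clear; lia.
  apply: leq_trans step1 _.
  apply: leq_trans (leq_mul (leq_exp_base (3 * x) hn) (leqnn _)) _.
  by rewrite -expnM (_ : 2 * K * (3 * x) = 6 * K * x); clear; lia.
have wx : 0 < w ^ (6 * K * x) by rewrite expn_gt0 wpos.
apply: (leq_cancel_mul wx); rewrite (mulnC u`!); apply: leq_trans step2.
rewrite -mulnA leq_mul //.
apply: leq_trans (_ : w ^ (2 * (1 + 2 * K)) * w ^ (6 * K * x) <= _).
  rewrite leq_mul // (mulnC 2 (1 + _)) expnM leq_exp_base // expnD leq_mul // expn1.
  by clear -w0; lia.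
rewrite -expnD leq_pexp2l //; move: w0 wy x0; clear; nia.
Qed.
End Estimates.

(** * Descent through the centre sizes *)

(** Each member is its own centre, witnessed by the singleton family; this starts the descent at
    size [n]. *)
Lemma restrS_self (T : finType) (r : nat) (n : nat) (F : {set {set T}}) :
  (forall A, A \in F -> #|A| <= n) -> restrS F (centers r n F) = F.
Proof.
move=> Fn; apply/setP => A; apply/restrSP/idP => [[]//|AF]; split=> //.
exists A => //; apply/centersP; split; first exact: Fn.
exists [set A]; rewrite ?sub1set //; apply/spreadP; split.
- by exists A; rewrite set11.
- by move=> B /set1P->.
move=> Z AZ; rewrite cards1.
have [->|neAZ] := eqVneq A Z.
  by rewrite subnn muln1 -(cards1 Z) subset_leq_card //; apply/subsetP => B; rewrite inE => /andP[].
rewrite (_ : restr _ _ = set0) ?cards0 //; apply/setP => B; rewrite !inE.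
by apply/negP => /andP[/eqP-> ZA]; case/eqP: neAZ; apply/eqP; rewrite eqEsubset AZ.
Qed.

Lemma card_setD_trans (T : finType) (A B C : {set T}) : #|A :\: C| <= #|A :\: B| + #|B :\: C|.
Proof.
apply: leq_trans (leq_card_setU _ _); apply/subset_leq_card/subsetP => x.
by rewrite !inE => /andP[-> ->]; case: (x \in B).
Qed.

(* Sizes of the parameters, for [i = u / w^6], [x = u / w^4], [r = u / w^2]. *)
Lemma parameters_exist K w u : 5000 + 20 * K <= w -> w ^ 16 <= u ->
  exists i x r, [/\ 0 < i, (2 * K + 13) * i <= x, 8 * u <= (w ^ 8 - 8) * i,
    u <= x * w ^ 4 & 1000 * (w * x) <= u] /\
   [/\ r * w ^ 2 <= u, 8 < r & 8 * u <= (r - 8) * w ^ 3] /\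
   [/\ 2 * (w * x + w ^ 3) <= r, 1024 * (u + w ^ 3) <= w ^ 3 * r & 256 * w ^ 3 <= r].
Proof.
move=> w0 hu.
have pw k : 0 < w ^ k by rewrite expn_gt0; move: w0; clear; lia.
have le k : k <= 16 -> w ^ k <= u.
  by move=> k16; apply: leq_trans hu; rewrite leq_pexp2l //; apply: (pw 1).
have w5 : 5000 <= w by move: w0; clear; lia.
have wK : 4 * K + 26 <= w by move: w0; clear; lia.
(* [i] and [x] are rounded up, [r] down; [u >= w^16] keeps the rounding within a factor 2. *)
pose i := (u %/ w ^ 6).+1; pose x := (u %/ w ^ 4).+1; pose r := u %/ w ^ 2.
have i1 : u <= i * w ^ 6 by apply/ltnW/ltn_ceil.
have i2 : i * w ^ 6 <= 2 * u.
  by rewrite (mulSn (u %/ _)) mul2n -addnn leq_add ?le // leq_divM.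
have x1 : u <= x * w ^ 4 by apply/ltnW/ltn_ceil.
have x2 : x * w ^ 4 <= 2 * u.
  by rewrite (mulSn (u %/ _)) mul2n -addnn leq_add ?le // leq_divM.
have r1 : r * w ^ 2 <= u by apply: leq_divM.
have r3 : w ^ 14 <= r.
  by rewrite leq_divRL // -expnD.
have r2 : u <= 2 * r * w ^ 2.
  have : u < r.+1 * w ^ 2 by apply: ltn_ceil.
  have : w ^ 2 <= r * w ^ 2 by rewrite leq_pmull // (leq_trans _ r3).
  by rewrite mulSn; clear; lia.
have E k l : w ^ (k + l) = w ^ k * w ^ l by rewrite expnD.
have r4 : 5000 * w ^ 3 <= r.
  apply: leq_trans r3; apply: leq_trans (_ : w * w ^ 3 <= _); first by rewrite leq_mul.
  by rewrite -expnS leq_pexp2l //; apply: (pw 1).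
have w3 : w <= w ^ 3 by rewrite -{1}(expn1 w) leq_pexp2l //; apply: (pw 1).
have r5 : 16 <= r by apply: leq_trans r4; move: w5 w3; clear; lia.
have rw : 2500 * u <= w ^ 3 * r.
  apply: leq_trans (_ : 2500 * (2 * r * w ^ 2) <= _); first by rewrite leq_mul2l.
  rewrite (expnS w 2); move: w5 (w ^ 2); clear => w5 v; nia.
have wx : 1000 * (w * x) <= r.
  rewrite -(leq_pmul2r (pw 4)).
  apply: leq_trans (_ : 1000 * (w * (2 * u)) <= _).
    by rewrite -2!mulnA leq_mul2l /= leq_mul2l x2 orbT.
  apply: leq_trans (_ : 1000 * (w * (2 * (2 * r * w ^ 2))) <= _).
    by rewrite leq_mul2l /= leq_mul2l leq_mul2l r2 !orbT.
  rewrite (_ : w ^ 4 = w * w * w ^ 2); last by rewrite (E 2 2) expnS expn1.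
  move: w5 (w ^ 2); clear => w5 v.
  rewrite (_ : 1000 * (w * (2 * (2 * r * v))) = 4000 * (w * r * v)); last by clear; lia.
  rewrite (_ : r * (w * w * v) = w * (w * r * v)); last by clear; lia.
  by rewrite leq_mul // (leq_trans _ w5).
have ru : r <= u by apply: leq_div.
exists i, x, r; split; [|split]; split=> //.
- rewrite -(leq_pmul2r (pw 6)) -mulnA.
  apply: leq_trans (leq_mul (leqnn _) i2) _.
  apply: leq_trans (_ : w * u <= _).
    by rewrite mulnA leq_mul //; move: wK; clear; lia.
  rewrite (E 2 4) mulnCA leq_mul // -(expn1 w) -expnM mul1n leq_pexp2l //; apply: (pw 1).
- apply: leq_trans (_ : 8 * (i * w ^ 6) <= _); first by rewrite leq_mul2l.
  rewrite mulnA mulnAC leq_mul // (E 2 6).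
  have w2 : 5000 <= w ^ 2 by apply: leq_trans w5 _; rewrite -{1}(expn1 w) leq_pexp2l //; apply: (pw 1).
  move: w2 (pw 6); clear; move: (w ^ 2) (w ^ 6) => p q p1 q1.
  have : 16 * q <= p * q by rewrite leq_mul // (leq_trans _ p1).
  by move: q1; clear; lia.
- exact: leq_trans wx ru.
- by move: r5; clear; lia.
- have : r * w ^ 3 <= 2 * (r - 8) * w ^ 3 by rewrite leq_mul //; move: r5; clear; lia.
  by move: rw; rewrite -mulnA (mulnC r); move: (w ^ 3 * r) ((r - 8) * w ^ 3); clear; lia.
- by move: wx r4; move: (w ^ 3) (w * x); clear; lia.
- by move: rw (le 3 isT); move: (w ^ 3 * r) (w ^ 3); clear; lia.
- by move: r4; move: (w ^ 3); clear; lia.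
Qed.

Lemma t_intersecting_approximation K w n t (F : {set {set 'I_n * 'I_n}}) :
  t <= n -> 0 < n -> 5000 + 20 * K <= w -> n * w ^ 16 <= (n - t) ^ 2 -> n <= w ^ (2 * K) ->
  (forall A, A \in F -> in_Sigma A) -> t_intersecting t F ->
  exists S : {set {set 'I_n * 'I_n}},
    [/\ forall A, A \in S -> partial_perm A,
      forall A, A \in S -> 1000 * (#|A| - t) <= n - t,
      #|F :\: restrS F S| * n < (n - t)`! & t_intersecting t S].
Proof.
move=> tn n0 w0 hu hn FS Ft; set u := n - t in hu *.
have un : u <= n by apply: leq_subr.
have u16 : w ^ 16 <= u.
  rewrite -(leq_pmul2l n0); apply: leq_trans hu _.
  by rewrite expnS expn1 leq_mul.
have w1 : 0 < w by move: w0; clear; lia.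
have w8 : 0 < w ^ 8 by rewrite expn_gt0 w1.
have u0 : 0 < u by apply: leq_trans u16; rewrite expn_gt0 w1.
have [i [x [r [[i0 Ki iu xu wx] [[ru r8 ru'] [zr ur m1r]]]]]] := parameters_exist w0 u16.
have ix : i <= x by apply: leq_trans Ki; rewrite leq_pmull // addn_gt0 orbT.
have x0 : 0 < x by apply: leq_trans ix.
have xu' : x <= u.
  apply: leq_trans wx; rewrite mulnA leq_pmull // muln_gt0 //.
have Fn A : A \in F -> #|A| = n by move=> /FS[s ->]; rewrite card_perm_graph.
pose L j := centers (w ^ 8) (t + j) F.
have w88 : 8 < w ^ 8.
  apply: leq_trans (_ : w ^ 1 <= _); last by rewrite leq_pexp2l.
  by rewrite expn1; move: w0; clear; lia.
have Lsize j X : X \in L j -> #|X| <= t + j by move=> /centersP[].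
have Lint j X X' : X \in L j -> X' \in L j -> t - i <= #|X :&: X'|.
  move=> /centersP[_ [H1 H1F s1]] /centersP[_ [H2 H2F s2]].
  rewrite leq_subLR addnC; exact: (spread_near tn Fn Ft w88 iu H1F H2F s1 s2).
have w16 : 16 * w ^ 8 <= u.
  apply: leq_trans u16; rewrite (expnD w 8 8) leq_mul //.
  apply: leq_trans (_ : w ^ 1 <= _); last by rewrite leq_pexp2l.
  by rewrite expn1; move: w0; clear; lia.
have layer j : x <= j -> j < u ->
    #|restrS F (L j.+1) :\: restrS F (L j)| * (4 * n) ^ 2 <= u`!.
  move=> xj ju; set R := _ :\: _.
  have [->|R0] := eqVneq R set0; first by rewrite cards0.
  have [y [y1 y2 y3 hy]] := card_remainder_le FS w8 (Lsize j.+1) (Lint j.+1) R0.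
  have [z yz] : exists z, y = t + z by exists (y - t); move: y1; clear; lia.
  apply: (@layer_arith w K n t tn w0 hu hn i j.+1 z) => //.
  - by apply: leq_trans Ki _; apply: leqW.
  - by apply: leq_trans xu _; rewrite leq_mul // leqW.
  - by move: y1; rewrite yz ltn_add2l.
  - by rewrite leq_subRL // -yz.
  - by rewrite -yz -subnDA -yz.
have layers d : d <= u - x -> #|F :\: restrS F (L (u - d))| * (4 * n) ^ 2 <= d * u`!.
  elim: d => [_|d IH du].
    rewrite subn0 /L subnKC // restrS_self => [|A /Fn->//].
    by rewrite setDv cards0.
  have e : u - d = (u - d.+1).+1 by move: du; clear; lia.
  apply: leq_trans (leq_mul (card_setD_trans _ (restrS F (L (u - d))) _) (leqnn _)) _.
  rewrite mulnDl mulSn addnC leq_add ?IH //; last by apply: ltnW.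
  rewrite e; apply: layer; move: du xu'; clear; lia.
pose S := centers r (t + w * x) F.
have r0 : 0 < r by apply: ltn_trans r8.
have last : #|restrS F (L x) :\: restrS F S| * (4 * n) ^ 2 <= u`!.
  set R := _ :\: _.
  have [->|R0] := eqVneq R set0; first by rewrite cards0.
  have [y [y1 y2 y3 hy]] := card_remainder_le FS r0 (Lsize x) (Lint x) R0.
  have [z yz] : exists z, y = t + z by exists (y - t); move: y1; clear; lia.
  apply: (@final_arith w K n t w0 hn i x z r) => //.
  - by rewrite -leq_subRL.
  - by move: y1; rewrite yz ltn_add2l.
  - by rewrite leq_subRL // -yz.
  - by rewrite -yz -subnDA -yz.
exists S; split.
- move=> Y /centersP[_ [H HF /spreadP[[A AH] HY _]]].
  have [s es] := FS A (subsetP HF A AH).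
  by exists s; rewrite -es HY.
- move=> Y /centersP[qY _]; apply: leq_trans wx; rewrite leq_mul2l /=.
  by rewrite leq_subLR.
- have := layers (u - x) (leqnn _); rewrite subKn // => l1.
  have := card_setD_trans F (restrS F (L x)) (restrS F S).
  move: l1 last (fact_gt0 u); move: (u`!) => f.
  set b := #|F :\: restrS F S|; set b1 := #|F :\: restrS F (L x)|; set b2 := #|_| => l1 l2 f0 bb.
  (* The [u - x] layers and the last step number at most [n], each losing at most [u! / (4n)^2]. *)
  have bn : b * (16 * n) * n <= f * n.
    rewrite (_ : _ * n = b * (4 * n) ^ 2); last by rewrite expnMn expnS expn1; clear; lia.
    apply: leq_trans (leq_mul bb (leqnn _)) _; rewrite mulnDl.
    apply: leq_trans (leq_add l1 l2) _.
    rewrite -mulSnr mulnC leq_mul //; move: x0 xu' un u0; clear; lia.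
  rewrite leq_pmul2r // in bn; move: f0 bn; clear; nia.
(* [w ^ 3] serves both as the defect of [r]-spread centres and as the cutoff for first-round
   fragments. *)
- apply: (@centers_t_intersecting _ n t r (t + w * x) (w ^ 3) (w ^ 3)) => //.
  + exact: leq_addr.
  + by rewrite addKn.
Qed.

(** * From real exponents to integer roots *)

Lemma INR_expn a k : INR (a ^ k) = pow (INR a) k.
Proof. by elim: k => [|k IH] //; rewrite expnS mult_INR IH. Qed.

Lemma nat_root_exists k n : 0 < k -> exists w, w ^ k <= n < w.+1 ^ k.
Proof.
move=> k0; have ex0 : exists w, w ^ k <= n by exists 0; rewrite exp0n.
have bnd w : w ^ k <= n -> w <= n.
  by apply: leq_trans; case: k k0 {ex0} => // k _; case: w => // w; rewrite expnS leq_pmulr // expn_gt0.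
have [w wn maxw] := ex_maxnP ex0 bnd.
by exists w; rewrite wn ltnNge; apply/negP => /maxw; rewrite ltnn.
Qed.

(** Since [w ^ K <= n] and [K eps >= 8], [w ^ 16] is at most [n] to the power [2 eps]; logarithms
    make this precise. *)
Lemma root_power_le (eps : R) (K w n u : nat) :
  (8 / eps <= INR K)%R -> (0 < eps)%R -> 0 < K -> 0 < w -> w ^ K <= n ->
  (Rpower (INR n) (1/2 + eps) < INR u)%R -> n * w ^ 16 <= u ^ 2.
Proof.
move=> Ke e0 K0 w0 wn nu.
have le_INR_ssr a b : a <= b -> (INR a <= INR b)%R by move=> /leP; apply: le_INR.
have n0 : 0 < n by apply: leq_trans wn; rewrite expn_gt0 w0.
have w1 : (0 < INR w)%R by apply: (lt_INR 0); apply/ltP.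
have n1 : (0 < INR n)%R by apply: (lt_INR 0); apply/ltP.
have K1 : (0 < INR K)%R by apply: (lt_INR 0); apply/ltP.
have l1 : (INR K * ln (INR w) <= ln (INR n))%R.
  rewrite -ln_pow //; have := le_INR_ssr _ _ wn; rewrite INR_expn => h.
  case: h => [h|->]; last exact: Rle_refl.
  by apply/Rlt_le/ln_increasing => //; apply: pow_lt.
have lw : (0 <= ln (INR w))%R.
  rewrite -ln_1; have : (1 <= INR w)%R by apply: (le_INR_ssr 1).
  case=> [h|<-]; last exact: Rle_refl.
  by apply/Rlt_le/ln_increasing => //; apply: Rlt_0_1.
have Ke' : (8 <= eps * INR K)%R.
  have := Rmult_le_compat_l eps _ _ (Rlt_le _ _ e0) Ke.
  by have -> : (eps * (8 / eps) = 8)%R by field; lra.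
have l2 : (16 * ln (INR w) <= 2 * eps * ln (INR n))%R by nra.
have exp_le a b : (a <= b)%R -> (exp a <= exp b)%R.
  by case=> [h|->]; [apply/Rlt_le/exp_increasing | apply: Rle_refl].
apply/leP/INR_le; rewrite mult_INR !INR_expn.
apply: (Rle_trans _ (exp (ln (INR n) + 16 * ln (INR w)))).
  rewrite exp_plus exp_ln //; apply: Req_le; congr Rmult.
  rewrite -Rpower_pow // /Rpower; congr (exp (_ * _)); simpl; lra.
apply: (Rle_trans _ (Rpower (INR n) (1/2 + eps) * Rpower (INR n) (1/2 + eps))).
  by rewrite -Rpower_plus; apply: exp_le; nra.
have p0 : (0 < Rpower (INR n) (1/2 + eps))%R by apply: exp_pos.
by rewrite /= Rmult_1_r; apply: Rmult_le_compat; lra.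
Qed.

Theorem theorem3p1 :
  forall eps : R, (0 < eps < 1/2)%R ->
  exists n0 : nat, forall n : nat, (n0 < n)%N ->
  forall t : nat,
    (Rpower (INR n) (99/100) < INR t)%R ->
    (INR t < INR n - Rpower (INR n) (1/2 + eps))%R ->
  forall F : {set {set 'I_n * 'I_n}},
    (forall A, A \in F -> in_Sigma A) ->
    t_intersecting t F ->
  exists S : {set {set 'I_n * 'I_n}},
    (forall A, A \in S -> partial_perm A) /\
    (forall A, A \in S -> (INR #|A| <= INR t + (1/1000) * INR (n - t))%R) /\
    (INR #|F :\: restrS F S| < (1 / INR n) * INR (n - t)`!)%R /\
    t_intersecting t S.
Proof.
move=> eps [e0 e1].
have [K0 hK0] := INR_unbounded (8 / eps).
pose K := K0.+1; have hK : (8 / eps <= INR K)%R by rewrite S_INR; lra.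
(* This threshold forces the integer [K]-th root [w] of [n] to be at least [5000 + 20 K]. *)
exists ((5000 + 20 * K) ^ K) => n n0n t _ ht F FS Ft.
have [//|w /andP[wn nw]] := @nat_root_exists K n.
have n0 : 0 < n by apply: leq_ltn_trans n0n.
have n1 : (0 < INR n)%R by apply: (lt_INR 0); apply/ltP.
have w0 : 5000 + 20 * K <= w.
  by rewrite -ltnS -(@ltn_exp2r _ _ K) // (ltn_trans n0n).
have wpos : 0 < w by apply: leq_trans w0.
have tn : t <= n.
  apply/leP/INR_le; have : (0 < Rpower (INR n) (1/2 + eps))%R by apply: exp_pos.
  lra.
have hu : n * w ^ 16 <= (n - t) ^ 2.
  apply: (root_power_le hK e0 _ wpos wn) => //.
  by rewrite minus_INR; [lra | apply/leP].
have hn : n <= w ^ (2 * K).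
  apply: leq_trans (ltnW nw) _; rewrite expnM leq_exp_base //.
  by rewrite expnS expn1 -addn1; move: w0; clear; nia.
have [S [Sp Ss Sn St]] := t_intersecting_approximation tn n0 w0 hu hn FS Ft.
exists S; split=> //; split=> [A AS|]; last split=> //.
  have h : 1000 * #|A| <= 1000 * t + (n - t) by move: (Ss A AS); clear; lia.
  move/leP/le_INR: h; rewrite -multE -plusE plus_INR !mult_INR (_ : INR 1000 = 1000%R); last first.
    by rewrite INR_IZR_INZ.
  lra.
move/ltP/lt_INR: Sn; rewrite mult_INR => Sn.
apply: (Rmult_lt_reg_r (INR n)) => //.
by rewrite (_ : (1 / INR n * _ * INR n = INR (n - t)`!)%R) //; field; lra.
Qed.
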